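(* Let $A$ be an $H^{\vee,\triangle}_3$-algebra and $M$ a non-trivial maximal modal deductive system of $A$. Let $M_0=\{x\in A:\nabla x\notin M\}$, $M_{1/2}=\{x\in A: x\notin M,\ \nabla x\in M\}$, and define $h:A\to\mathbb{C}_3$ by $h(x)=0$ if $x\in M_0$, $h(x)=\frac12$ if $x\in M_{1/2}$, $h(x)=1$ if $x\in M$. Then $h$ is a homomorphism from $A$ to $\mathbb{C}_3^{\to,\vee}$ and $h^{-1}(\{1\})=M$.
   Context: An $H^{\vee,\triangle}_3$-algebra is an algebra $(A,\to,\vee,\triangle,1)$ such that: $(A,\vee,1)$ is a join-semilattice with top $1$; $x\to(x\vee y)=1$ and $(x\to y)\to((x\vee y)\to y)=1$; whenever the infimum $x\wedge y$ exists, $\triangle(x\wedge y)=\triangle x\wedge\triangle y$; $(A,\to,1)$ satisfies $x\to(y\to x)=1$, $(x\to(y\to z))\to((x\to y)\to(x\to z))=1$, ($x\to y=1=y\to x$ implies $x=y$), and $((x\to y)\to z)\to(((z\to x)\to z)\to z)=1$; and $\triangle x\to x=1$, $((y\to\triangle y)\to(x\to\triangle\triangle x))\to\triangle(x\to y)=\triangle x\to\triangle\triangle y$, $(\triangle x\to\triangle y)\to\triangle x=\triangle x$. Define $\nabla x=(x\to\triangle x)\to\triangle x$. A modal deductive system is $D\subseteq A$ with $1\in D$; $x,x\to y\in D$ implies $y\in D$; $x\in D$ implies $\triangle x\in D$. Maximal means proper and not strictly contained in another proper modal deductive system; non-trivial means $M\ne A$. $\mathbb{C}_3^{\to,\vee}$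 is the chain $\{0<\frac12<1\}$ with $\vee=\max$, $x\to y=1$ if $x\le y$ and $x\to y=y$ otherwise, $\triangle0=\triangle\frac12=0$, $\triangle1=1$. *)

(* Defs.v *)
From mathcomp Require Import all_boot.
From mathcomp Require Import boolp classical_sets.

Set Implicit Arguments.
Unset Strict Implicit.
Unset Printing Implicit Defensive.

Local Open Scope classical_set_scope.

Section Infimum.
Variables (T : Type) (join : T -> T -> T).

Definition join_le (x y : T) : Prop := join x y = y.

Definition is_inf (x y z : T) : Prop :=
  [/\ join_le z x, join_le z y
    & forall w, join_le w x -> join_le w y -> join_le w z].

End Infimum.

Record h3Algebra := H3Algebra {
  h3_sort :> Type;
  h3_imp : h3_sort -> h3_sort -> h3_sort;
  h3_join : h3_sort -> h3_sort -> h3_sort;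
  h3_delta : h3_sort -> h3_sort;
  h3_one : h3_sort;
  joinA : forall x y z, h3_join x (h3_join y z) = h3_join (h3_join x y) z;
  joinC : forall x y, h3_join x y = h3_join y x;
  joinxx : forall x, h3_join x x = x;
  joinx1 : forall x, h3_join x h3_one = h3_one;
  imp_joinl : forall x y, h3_imp x (h3_join x y) = h3_one;
  imp_joinE : forall x y, h3_imp (h3_imp x y) (h3_imp (h3_join x y) y) = h3_one;
  (* If x /\ y exists, then delta x /\ delta y exists and is delta (x /\ y). *)
  delta_inf : forall x y z,
    is_inf h3_join x y z -> is_inf h3_join (h3_delta x) (h3_delta y) (h3_delta z);
  imp_K : forall x y, h3_imp x (h3_imp y x) = h3_one;
  imp_S : forall x y z,
    h3_imp (h3_imp x (h3_imp y z)) (h3_imp (h3_imp x y) (h3_imp x z)) = h3_one;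
  imp_anti : forall x y, h3_imp x y = h3_one -> h3_imp y x = h3_one -> x = y;
  imp_3val : forall x y z,
    h3_imp (h3_imp (h3_imp x y) z) (h3_imp (h3_imp (h3_imp z x) z) z) = h3_one;
  delta_le : forall x, h3_imp (h3_delta x) x = h3_one;
  delta_imp : forall x y,
    h3_imp (h3_imp (h3_imp y (h3_delta y)) (h3_imp x (h3_delta (h3_delta x))))
      (h3_delta (h3_imp x y))
    = h3_imp (h3_delta x) (h3_delta (h3_delta y));
  delta_peirce : forall x y,
    h3_imp (h3_imp (h3_delta x) (h3_delta y)) (h3_delta x) = h3_delta x
}.

Arguments h3_one {_}.

Definition nabla (A : h3Algebra) (x : A) : A :=
  h3_imp (h3_imp x (h3_delta x)) (h3_delta x).

Record modal_deductive_system (A : h3Algebra) (D : set A) : Prop := {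
  mds_one : D h3_one;
  mds_mp : forall x y, D x -> D (h3_imp x y) -> D y;
  mds_delta : forall x, D x -> D (h3_delta x)
}.

Definition maximal_mds (A : h3Algebra) (M : set A) : Prop :=
  [/\ modal_deductive_system M, M <> setT
    & ~ exists D : set A,
        [/\ modal_deductive_system D, D <> setT & M `<` D]].

Record is_hom (A B : h3Algebra) (f : A -> B) : Prop := {
  hom_imp : forall x y, f (h3_imp x y) = h3_imp (f x) (f y);
  hom_join : forall x y, f (h3_join x y) = h3_join (f x) (f y);
  hom_delta : forall x, f (h3_delta x) = h3_delta (f x);
  hom_one : f h3_one = h3_one
}.

Inductive C3 := C3_zero | C3_half | C3_one.

Definition C3_rank (x : C3) : nat :=
  match x with C3_zero => 0 | C3_half => 1 | C3_one => 2 end.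

Definition C3_le (x y : C3) : bool := C3_rank x <= C3_rank y.
Definition C3_join (x y : C3) : C3 := if C3_le x y then y else x.
Definition C3_imp (x y : C3) : C3 := if C3_le x y then C3_one else y.
Definition C3_delta (x : C3) : C3 :=
  match x with C3_one => C3_one | _ => C3_zero end.

Lemma C3_delta_inf x y z :
  is_inf C3_join x y z -> is_inf C3_join (C3_delta x) (C3_delta y) (C3_delta z).
Proof.
case=> zx zy; move=> /[dup] /(_ x) wx /(_ y) wy; move: zx zy wx wy.
rewrite /is_inf /join_le.
case: x; case: y; case: z => //= zx zy wx wy; split => // w; try by case: w.
all: by have := wx erefl erefl; have := wy erefl erefl.
Qed.

Definition C3_algebra : h3Algebra.
Proof.
apply: (@H3Algebra C3 C3_imp C3_join C3_delta C3_one);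
  try exact: C3_delta_inf; repeat case=> //.
Defined.

Section QuotientMap.
Variables (A : h3Algebra) (M : set A).

Definition M_zero : set A := [set x | ~ M (nabla x)].
Definition M_half : set A := [set x | ~ M x /\ M (nabla x)].

(* M_zero, M_half and M partition A when M is a modal deductive system, so the
   last branch is the case x \in M; see h_zero, h_half and h_one. *)
Definition h (x : A) : C3_algebra :=
  if `[< M_zero x >] then C3_zero
  else if `[< M_half x >] then C3_half
  else C3_one.

Lemma h_zero x : M_zero x -> h x = C3_zero.
Proof. by rewrite /h; case: asboolP. Qed.

Lemma h_half x : M_half x -> h x = C3_half.
Proof. by move=> Hx; rewrite /h; case: asboolP; [case: Hx|case: asboolP]. Qed.

Lemma h_one x : modal_deductive_system M -> M x -> h x = C3_one.
Proof.
move=> mM Mx; have Mn : M (nabla x).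
  have Md := mds_delta mM Mx.
  by apply: (mds_mp mM Md); rewrite imp_K; apply: mds_one.
by rewrite /h; case: asboolP => // _; case: asboolP => // -[].
Qed.

End QuotientMap.

(* Main.v *)
Require Import Defs.
From mathcomp Require Import all_boot.
From mathcomp Require Import boolp classical_sets.

Local Open Scope classical_set_scope.

(** For x outside a maximal modal deductive system M, the set of all y with
    delta x -> y in M is a modal deductive system strictly containing M, hence
    everything: modulo M, delta x is a least element.  As x -> delta x is fixed
    by delta, either x -> delta x lies in M, and x itself is least modulo M, or
    x -> delta x is least modulo M.  These are the cases h x = 0 and
    h x = 1/2, and the operations are then computed case by case; the axiom
    [delta_imp] identifies any two elements of the second kind. *)

Local Notation "x ~> y" := (h3_imp x y) (at level 55, right associativity).
Local Notation "'d' x" := (h3_delta x) (at level 10, x at level 9).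

Section H3Algebra.
Variable A : h3Algebra.
Implicit Types x y z : A.

Lemma imp_x1 x : x ~> h3_one = h3_one.
Proof. by rewrite -{1}(joinx1 x) imp_joinl. Qed.

Lemma imp_1_eq1 x : h3_one ~> x = h3_one -> x = h3_one.
Proof. by move=> x1; apply: imp_anti; rewrite ?imp_x1. Qed.

Lemma imp_xx x : x ~> x = h3_one.
Proof. by have := imp_S x (x ~> x) x; rewrite !imp_K => /imp_1_eq1/imp_1_eq1. Qed.

Lemma imp_1x x : h3_one ~> x = x.
Proof.
apply: imp_anti; last exact: imp_K.
by have := imp_S (h3_one ~> x) h3_one x;
   rewrite imp_xx imp_x1 => /imp_1_eq1/imp_1_eq1.
Qed.

Lemma imp_contract x y : x ~> x ~> y = h3_one -> x ~> y = h3_one.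
Proof. by move=> xxy; have := imp_S x x y; rewrite xxy imp_xx !imp_1x. Qed.

(** At [x = y = 1], [delta_imp] and [delta_peirce] together give [d 1 = d 1 ~> d (d 1)]; contraction
    then forces this element to be [1]. *)
Lemma delta_one : d h3_one = h3_one :> A.
Proof.
have := delta_imp (h3_one : A) h3_one; rewrite imp_xx !imp_1x delta_peirce => dE.
by rewrite dE; apply: imp_contract; rewrite -dE imp_xx.
Qed.

Lemma delta_delta x : d (d x) = d x.
Proof.
apply: imp_anti; first exact: delta_le.
by have := delta_imp x x; rewrite imp_xx delta_one imp_x1.
Qed.

Lemma delta_imp_le x y : d (x ~> y) ~> d x ~> d y = h3_one.
Proof. by have := delta_imp x y; rewrite !delta_delta => <-; exact: imp_K. Qed.

(** Instance of [delta_imp] at [x] and [d x]: idempotence of delta makes the right side and the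
    premise [d x ~> d (d x)] trivial. *)
Lemma imp_delta_le x : (x ~> d x) ~> d (x ~> d x) = h3_one.
Proof. by have := delta_imp x (d x); rewrite !delta_delta !imp_xx imp_1x. Qed.

End H3Algebra.

Lemma C3_le_anti (a b : C3) : C3_le a b -> C3_le b a -> a = b.
Proof. by case: a; case: b. Qed.

Section MaximalSystem.
Variables (A : h3Algebra) (M : set A).
Hypothesis maxM : maximal_mds M.
Implicit Types x y z : A.

Let mM : modal_deductive_system M. Proof. by case: maxM. Qed.

Lemma mem_one_imp x y : x ~> y = h3_one -> M (x ~> y).
Proof. by move=> ->; exact: mds_one. Qed.

Lemma mem_impr x y : M y -> M (x ~> y).
Proof. by move=> My; apply: (mds_mp mM My); apply: mem_one_imp; exact: imp_K. Qed.

Lemma mem_impS x y z : M (x ~> y ~> z) -> M (x ~> y) -> M (x ~> z).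
Proof.
move=> xyz xy; apply: (mds_mp mM xy); apply: (mds_mp mM xyz).
by apply: mem_one_imp; exact: imp_S.
Qed.

Lemma mem_imp_trans x y z : M (x ~> y) -> M (y ~> z) -> M (x ~> z).
Proof. by move=> xy yz; apply: mem_impS xy; exact: mem_impr. Qed.

Lemma imp_delta_mds x : modal_deductive_system [set y | M (d x ~> y)].
Proof.
split=> /=.
- by apply: mem_impr; exact: mds_one.
- by move=> y z xy xyz; exact: mem_impS xyz xy.
(* Since [d x = d (d x)], delta distributes over [d x ~> y] without changing the premise. *)
- move=> y /(mds_delta mM) dxy; rewrite -(delta_delta A x).
  by apply: (mds_mp mM dxy); apply: mem_one_imp; exact: delta_imp_le.
Qed.

Lemma delta_least x y : ~ M x -> M (d x ~> y).
Proof.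
move=> Mx; have [_ _ noD] := maxM; apply: contrapT => nxy.
apply: noD; exists [set y | M (d x ~> y)]; split.
- exact: imp_delta_mds.
- by move=> /(congr1 (fun D : set A => D y)) /= E; apply: nxy; rewrite E.
- split; first by move=> z Mz; exact: mem_impr.
  by move=> /(_ x) /= sub; apply/Mx/sub/mem_one_imp/delta_le.
Qed.

Lemma imp_delta_least x y : ~ M (x ~> d x) -> M ((x ~> d x) ~> y).
Proof.
move=> nx; apply: mem_imp_trans (delta_least _ y nx).
by apply: mem_one_imp; exact: imp_delta_le.
Qed.

(** Describes the three values of [h] by least elements modulo [M] instead of by [nabla], the form
    in which the operations are computed. *)
Variant h_spec x : C3 -> Prop :=
| HSpecZero of ~ M x & (forall y, M (x ~> y)) : h_spec x C3_zero
| HSpecHalf of ~ M x & (forall y, M ((x ~> d x) ~> y)) & ~ M (x ~> d x) :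
    h_spec x C3_half
| HSpecOne of M x : h_spec x C3_one.

Lemma hP x : h_spec x (h M x).
Proof.
have [Mx|Mx] := pselect (M x); first by rewrite h_one //; constructor.
have [xd|xd] := pselect (M (x ~> d x)).
  rewrite h_zero; first by constructor=> // y; apply/(mem_imp_trans _ _ _ xd)/delta_least.
  (* As [nabla x] is [(x ~> d x) ~> d x], having it in [M] would put [d x], hence [x], in [M]. *)
  move=> /(mds_mp mM xd) Md; apply: Mx.
  by apply: (mds_mp mM Md); apply: mem_one_imp; exact: delta_le.
rewrite h_half; first by constructor=> // y; exact: imp_delta_least.
by split=> //; exact: imp_delta_least.
Qed.

Lemma h_eq1 x : h M x = C3_one <-> M x.
Proof. by case: hP. Qed.

Lemma h_eq0 x : ~ M x -> M (x ~> d x) -> h M x = C3_zero.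
Proof. by case: hP. Qed.

Lemma h_mono x y : M (x ~> y) -> C3_le (h M x) (h M y).
Proof.
move=> xy; case: (hP x) => [Mx _|Mx _ nxd|Mx]; case: (hP y) => [My yl|//|//]//.
- by case: nxd; exact: mem_imp_trans xy (yl _).
- by case: My; exact: mds_mp Mx xy.
- by move=> My; case: My; exact: mds_mp Mx xy.
Qed.

(** By [delta_imp], [d x ~> d y] equals [((y ~> d y) ~> (x ~> d x)) ~> d (x ~> y)]. It lies in [M]
    because [d x] is least, and its premise does because [y ~> d y] is least. *)
Lemma mem_imp_half x y :
  ~ M x -> (forall z, M ((y ~> d y) ~> z)) -> M (x ~> y).
Proof.
move=> Mx yd; have := delta_least _ (d y) Mx.
have := delta_imp x y; rewrite !delta_delta => <- /(mds_mp mM (yd _)) Md.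
by apply: (mds_mp mM Md); apply: mem_one_imp; exact: delta_le.
Qed.

Lemma h_imp x y : h M (x ~> y) = C3_imp (h M x) (h M y).
Proof.
have [/h_eq1 My|My] := pselect (M y).
  rewrite My; have /h_eq1 -> : M (x ~> y) by apply/mem_impr/h_eq1.
  by case: (h M x).
case: (hP x) => [Mx xl|Mx xd nxd|Mx].
- by have /h_eq1 -> := xl y; case: (h M y).
- case: (hP y) => [_ yl|_ yd _|//].
    apply: h_eq0 => [xy|]; first by apply: nxd; exact: mem_imp_trans xy (yl _).
    (* Modulo [M], [y] is below [d x], so [x ~> y] is below [x ~> d x], which is least. *)
    apply: mem_imp_trans (xd _); apply: (mds_mp mM (mem_impr x _ (yl (d x)))).
    by apply: mem_one_imp; exact: imp_S.
  by apply/h_eq1; exact: mem_imp_half.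
- have -> : C3_imp C3_one (h M y) = h M y by case: (h M y).
  apply: C3_le_anti; apply: h_mono; last by apply: mem_one_imp; exact: imp_K.
  apply: mem_impS (mem_impr _ _ Mx); apply: mem_one_imp; exact: imp_xx.
Qed.

(** By [h_imp], the order on values puts [x ~> y] in [M], and [imp_joinE] turns this into the join
    being below [y] modulo [M]. *)
Lemma h_join_le x y : C3_le (h M x) (h M y) -> h M (h3_join x y) = h M y.
Proof.
move=> lexy; apply: C3_le_anti; apply: h_mono.
  have /h_eq1 xy : h M (x ~> y) = C3_one by rewrite h_imp /C3_imp lexy.
  by apply: (mds_mp mM xy); apply: mem_one_imp; exact: imp_joinE.
by rewrite joinC; apply: mem_one_imp; exact: imp_joinl.
Qed.

Lemma h_join x y : h M (h3_join x y) = C3_join (h M x) (h M y).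
Proof.
rewrite /C3_join; case: ifP => [|/negbT]; first exact: h_join_le.
rewrite /C3_le -ltnNge => /ltnW; rewrite joinC; exact: h_join_le.
Qed.

Lemma h_delta x : h M (d x) = C3_delta (h M x).
Proof.
have [Mx|Mx] := pselect (M x).
  by rewrite !h_one //; exact: mds_delta.
rewrite h_eq0; first by case: hP.
  move=> Md; apply: Mx; apply: (mds_mp mM Md).
  by apply: mem_one_imp; exact: delta_le.
exact: delta_least.
Qed.

End MaximalSystem.

Theorem mainTheorem10 (A : h3Algebra) (M : set A)
    (maxM : maximal_mds M) (ntM : M <> setT) :
  is_hom (h M) /\ h M @^-1` [set (@h3_one C3_algebra)] = M.
Proof.
split; last by apply/seteqP; split=> x /= /(h_eq1 _ _ maxM).
split; [exact: h_imp | exact: h_join | exact: h_delta |].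
by apply/h_eq1 => //; case: maxM => -[].
Qed.
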